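(* In the voting game with incomplete information about types described in the context, the best equilibrium of liquid democracy (in terms of information aggregation) yields a probability that the outcome matches the state at least as large as the best equilibrium of direct democracy and at least as large as the best equilibrium of representative democracy.
   Context: Voters $\mathcal N=\{1,\dots,N\}$ choose between alternatives $A$ and $B$ by simple majority of votes cast, ties broken uniformly at random. Unknown state $\omega\in\{a,b\}$ with common prior $\Pr(\omega=a)=\pi\in(0,1)$. Each voter $i$ privately observes her type $t_i=(p_i,q_i)$, drawn independently across voters from $P_i\times Q_i$, with $P_i$ a commonly known distribution on $\{A,B,I\}$ and $Q_i$ a commonly known distribution on $[1/2,1]$. An independent ($p_i=I$) gets payoff 1 if the outcome matches the state ($A$ with $a$, $B$ with $b$), else 0; a partisan with $p_i=A$ (resp. $B$) gets 1 iff the outcome is $A$ (resp. $B$). Voter $i$ then observes a private signal $s_i\in\{a,b\}$ with $\Pr(s_i=\omega\mid\omega)=q_i$, conditionally independent. Direct democracy (DD): actions are vote for $A$, vote for $B$, abstain. Liquid democracy (LD): additionally delegate to another voter $j$; delegation is transitive, votes held by voters in a delegation cycle are abstained, and a non-delegating voter casts all votes she holds (own plus delegated) for the same alternative or abstains them all. Representative democracy (RD): a fixed set of representatives $\mathcal J$ consists of a subset of $\mathcal N$ plus two non-strategic representatives $a^*,b^*\notin\mathcal N$ who always vote $A$ and $B$ respectively; a representative in $\mathcal N$ chooses among voting $A$, voting $B$, abstaining, and a non-representative chooses between abstaining and delegating to a representative in $\mathcal J$. An (ex-ante) strategy maps each type and signal to an action. A threshold strategy: partisans vote for their preferred alternative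 and, for each signal, whenever two independent types with different precisions take the same action, every independent type with intermediate precision takes it too. An equilibrium is a pure Bayes Nash equilibrium in undominated strategies in threshold strategies; a best equilibrium maximizes, among equilibria of the mechanism, the probability that the outcome matches the state. *)

(* Defs.v *)
From HB Require Import structures.
From mathcomp Require Import all_boot all_order all_algebra.
From mathcomp Require Import all_classical all_reals all_analysis.
Set Implicit Arguments. Unset Strict Implicit. Unset Printing Implicit Defensive.
Import Order.TTheory GRing.Theory Num.Theory.
Import numFieldNormedType.Exports.
Local Open Scope classical_set_scope.
Local Open Scope ring_scope.

Inductive party := PA | PB | PI.
Definition party_code (p : party) : 'I_3 :=
  match p with PA => inord 0 | PB => inord 1 | PI => inord 2 end.
Definition party_decode (k : 'I_3) : party :=
  match val k with 0 => PA | 1 => PB | _ => PI end.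
Lemma party_codeK : cancel party_code party_decode.
Proof. by case; rewrite /party_decode /= inordK. Qed.
HB.instance Definition _ := Finite.copy party (can_type party_codeK).

(* ---------- Actions ----------
   Vote true  = vote for A,  Vote false = vote for B,  Abst = abstain,
   Del j = delegate to voter j (in N),
   DelStar true = delegate to a*, DelStar false = delegate to b*
   (the two non-strategic representatives of RD). *)
Inductive act (N : nat) := Vote of bool | Abst | Del of 'I_N | DelStar of bool.
Arguments Abst {N}.

Definition act_code N (x : act N) : ((bool + unit) + 'I_N) + bool :=
  match x with
  | Vote b => inl (inl (inl b)) | Abst => inl (inl (inr tt))
  | Del j => inl (inr j) | DelStar b => inr b end.
Definition act_decode N (y : ((bool + unit) + 'I_N) + bool) : act N :=
  match y with
  | inl (inl (inl b)) => Vote _ b | inl (inl (inr _)) => Abst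
  | inl (inr j) => Del j | inr b => DelStar _ b end.
Lemma act_codeK N : cancel (@act_code N) (@act_decode N).
Proof. by case. Qed.
HB.instance Definition _ N := Finite.copy (act N) (can_type (@act_codeK N)).

(* RD J: J is the set of representatives belonging to N; a* and b* are
   always additionally representatives. *)
Inductive mech (N : nat) := DD | LD | RD of {set 'I_N}.
Arguments DD {N}. Arguments LD {N}.

Definition allowed N (M : mech N) (i : 'I_N) (x : act N) : bool :=
  match M, x with
  | DD, Vote _ | DD, Abst => true
  | LD, Vote _ | LD, Abst => true
  | LD, Del j => j != i
  | RD J, Vote _ => i \in J
  | RD J, Abst => true
  | RD J, Del j => (i \notin J) && (j \in J)
  | RD J, DelStar _ => i \notin J
  | _, _ => false
  end.

(* ---------- Aggregation ----------
   resolve a n i : where the vote of voter i ends up, following the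
   (transitive) delegation chain with fuel n.  Some true = counted for A,
   Some false = counted for B, None = abstained (including votes held in a
   delegation cycle, which never reach a non-delegating voter). *)
Fixpoint resolve N (a : 'I_N -> act N) (n : nat) (i : 'I_N) : option bool :=
  match n with
  | 0 => None
  | n'.+1 =>
    match a i with
    | Vote b => Some b
    | Abst => None
    | DelStar b => Some b
    | Del j => resolve a n' j
    end
  end.

(* fuel N.+1 suffices: a chain reaching a non-delegating voter visits at most
   N distinct voters; otherwise it is in/leads into a cycle *)
Definition vote_of N (a : 'I_N -> act N) (i : 'I_N) := resolve a N.+1 i.

(* own votes of the non-strategic representatives a*, b* (only in RD) *)
Definition extra_votes N (M : mech N) : nat :=
  match M with RD _ => 1 | _ => 0 end.

Definition tally N (M : mech N) (a : 'I_N -> act N) (b : bool) : nat :=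
  #|[set i | vote_of a i == Some b]| + extra_votes M.

Definition win_prob {R : realType} N (M : mech N) (a : 'I_N -> act N)
  (X : bool) : R :=
  let tX := tally M a X in let tY := tally M a (~~ X) in
  if (tY < tX)%N then 1 else if tX == tY then 2^-1 else 0.

(* utility of a type with party p when outcome is X and state is w
   (true = A / state a, false = B / state b) *)
Definition util {R : realType} (p : party) (X w : bool) : R :=
  match p with
  | PI => if X == w then 1 else 0
  | PA => if X then 1 else 0
  | PB => if X then 0 else 1
  end.

(* ---------- Strategies ----------
   A (pure, ex-ante) strategy of a voter maps her type (p, q) and signal s
   (true = signal a, false = signal b) to an action. *)
Definition strategy (R : realType) N := party -> R -> bool -> act N.

Definition prec_set {R : realType} : set R := `[2^-1, 1]%classic.

Section Game.
Context {R : realType} (N : nat) (pi : R) (P : 'I_N -> party -> R)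
        (Q : 'I_N -> probability R R).

Definition prior (w : bool) : R := if w then pi else 1 - pi.

Definition sig_prob (q : R) (s w : bool) : R := if s == w then q else 1 - q.

Definition act_prob (j : 'I_N) (sj : strategy R N) (w : bool) (x : act N) : R :=
  \sum_(p : party) P j p *
    (\int[Q j]_(q in prec_set)
       (sig_prob q w w * (sj p q w == x)%:R
        + sig_prob q (~~ w) w * (sj p q (~~ w) == x)%:R)).

Definition exp_util (M : mech N) (p : party) (a : 'I_N -> act N) (w : bool) : R :=
  win_prob M a true * util p true w + win_prob M a false * util p false w.

Definition posterior (q : R) (s w : bool) : R :=
  prior w * sig_prob q s w / (prior true * sig_prob q s true
                              + prior false * sig_prob q s false).

Definition interim_EU (M : mech N) (sigma : 'I_N -> strategy R N) (i : 'I_N)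
  (p : party) (q : R) (s : bool) (x : act N) : R :=
  \sum_(w : bool) posterior q s w *
    \sum_(a : {ffun 'I_N -> act N} | a i == x)
       (\prod_(j | j != i) act_prob j (sigma j) w (a j)) * exp_util M p a w.

Definition valid_strategy (M : mech N) (i : 'I_N) (si : strategy R N) : Prop :=
  (forall p q s, allowed M i (si p q s)) /\
  (forall p s x, measurable [set q | prec_set q /\ si p q s = x]).

Definition valid_profile (M : mech N) (sigma : 'I_N -> strategy R N) : Prop :=
  forall i, valid_strategy M i (sigma i).

(* the action by which a partisan of alternative b votes for b: directly
   (DD, LD, representatives in RD) or by delegating to a*/b*
   (non-representatives in RD, who cannot vote themselves) *)
Definition partisan_act (M : mech N) (i : 'I_N) (b : bool) : act N :=
  match M with
  | RD J => if i \in J then Vote N b else DelStar N b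
  | _ => Vote N b
  end.

Definition threshold_strategy (M : mech N) (i : 'I_N) (si : strategy R N) : Prop :=
  (forall q s, si PA q s = partisan_act M i true) /\
  (forall q s, si PB q s = partisan_act M i false) /\
  (forall s q1 q q2, prec_set q1 -> prec_set q2 -> q1 < q -> q < q2 ->
      si PI q1 s = si PI q2 s -> si PI q s = si PI q1 s).

Definition weakly_dominated (M : mech N) (i : 'I_N) (p : party) (q : R)
  (s : bool) (x : act N) : Prop :=
  exists2 y, allowed M i y &
    (forall tau, valid_profile M tau ->
        interim_EU M tau i p q s x <= interim_EU M tau i p q s y) /\
    (exists2 tau, valid_profile M tau &
        interim_EU M tau i p q s x < interim_EU M tau i p q s y).

Definition equilibrium (M : mech N) (sigma : 'I_N -> strategy R N) : Prop :=
  valid_profile M sigma /\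
  (forall i, threshold_strategy M i (sigma i)) /\
  (forall i p q s, prec_set q ->
     ~ weakly_dominated M i p q s (sigma i p q s)) /\
  (forall i p q s x, prec_set q -> allowed M i x ->
     interim_EU M sigma i p q s x <= interim_EU M sigma i p q s (sigma i p q s)).

Definition welfare (M : mech N) (sigma : 'I_N -> strategy R N) : R :=
  \sum_(w : bool) prior w *
    \sum_(a : {ffun 'I_N -> act N})
       (\prod_(j : 'I_N) act_prob j (sigma j) w (a j)) * win_prob M a w.

End Game.

(* Main.v *)
Require Import Defs.
From HB Require Import structures.
From mathcomp Require Import all_boot all_order all_algebra.
From mathcomp Require Import ring lra.
From mathcomp Require Import all_classical all_reals all_analysis measurable_realfun.
Set Implicit Arguments. Unset Strict Implicit. Unset Printing Implicit Defensive.
Import Order.TTheory GRing.Theory Num.Theory.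
Import numFieldNormedType.Exports.
Local Open Scope classical_set_scope.
Local Open Scope ring_scope.

(** Once partisans vote for their own alternative, which is dominant, the
    independents play a common-interest game, and the welfare of a profile is a
    multilinear function of its vector of action probabilities.  Delegating to
    [a*] or [b*] under RD amounts to voting under LD, so every equilibrium of DD
    or RD induces a sincere LD profile with the same welfare, and it suffices
    that a welfare maximizer over the closure of the vectors of sincere LD
    profiles comes from an equilibrium.

    Ties are broken by maximizing lexicographically, over that compact set, the
    welfare, then a functional that strictly increases along weak dominance,
    then an injective ranking of the actions.  Against such a maximizer, the
    lexicographically best action of an independent is unique for each precision
    and signal; since all the payoffs are affine in the precision, it defines a
    threshold strategy.  It is undominated and optimal for every type, and any
    strategies whose vectors converge to the maximizer differ from it with
    vanishing probability, so that it attains the maximizer. *)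

(** * Bounded measurable functions of the precision *)

Section BoundedMeasurable.
Context {R : realType}.
Implicit Types f g : R -> R.

Lemma measurable_prec_set : measurable (@prec_set R).
Proof. exact: measurable_itv. Qed.
Hint Resolve measurable_prec_set : core.

Definition bmeas f :=
  measurable_fun prec_set f /\
  exists M : R, forall q, prec_set q -> `|f q| <= M.

Lemma bmeas_cst (c : R) : bmeas (fun=> c).
Proof. by split; [exact: measurable_cst | exists `|c|]. Qed.

Lemma bmeas_id : bmeas id.
Proof.
split; first exact: measurable_id.
exists 1 => q; rewrite /prec_set /= in_itv /= => /andP[q0 q1].
by rewrite ger0_norm //; lra.
Qed.

Lemma bmeasD f g : bmeas f -> bmeas g -> bmeas (fun q => f q + g q).
Proof.
move=> [mf [A fA]] [mg [B gB]]; split; first exact: measurable_funD.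
by exists (A + B) => q Dq; rewrite (le_trans (ler_normD _ _)) // lerD ?fA ?gB.
Qed.

Lemma bmeasM f g : bmeas f -> bmeas g -> bmeas (fun q => f q * g q).
Proof.
move=> [mf [A fA]] [mg [B gB]]; split; first exact: measurable_funM.
by exists (A * B) => q Dq; rewrite normrM ler_pM ?fA ?gB.
Qed.

Lemma bmeasB f g : bmeas f -> bmeas g -> bmeas (fun q => f q - g q).
Proof.
move=> bf bg; rewrite (_ : (fun q => _) = (fun q => f q + (-1) * g q)).
  by apply: bmeasD => //; apply: bmeasM => //; exact: bmeas_cst.
by apply/funext => q; rewrite mulN1r.
Qed.

Lemma bmeas_sum (I : Type) (r : seq I) (p : pred I) (F : I -> R -> R) :
  (forall i, bmeas (F i)) -> bmeas (fun q => \sum_(i <- r | p i) F i q).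
Proof.
move=> bF; elim: r => [|i r IH].
  by under eq_fun do rewrite big_nil; exact: bmeas_cst.
under eq_fun do rewrite big_cons.
by case: (p i) => //; exact: bmeasD.
Qed.

Lemma bmeas_bool (b : R -> bool) :
  measurable_fun prec_set b -> bmeas (fun q => (b q)%:R).
Proof.
move=> mb; split; last first.
  by exists 1 => q _; case: (b q); rewrite ?normr1 ?normr0.
by apply: (@measurableT_comp _ _ _ _ _ _ (fun c : bool => c%:R : R)).
Qed.

Lemma bmeas_integrable (mu : probability R R) f :
  bmeas f -> mu.-integrable prec_set (EFin \o f).
Proof.
move=> [mf [M fM]]; apply: measurable_bounded_integrable => //.
  by rewrite (le_lt_trans (probability_le1 mu _)) // ltry.
exists M; split => [|y My q Dq]; first exact: num_real.
exact: (le_trans (fM _ Dq) (ltW My)).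
Qed.

(* A positive gap is rarely small: { 0 < f < 1/(n+1) } decreases to the
   empty set. *)
Lemma cvg_small_gap (mu : probability R R) f : bmeas f ->
  \int[mu]_(q in prec_set) (0 < f q < n.+1%:R^-1)%R%:R @[n --> \oo] --> (0 : R).
Proof.
move=> bf.
have mb n : measurable_fun prec_set (fun q => 0 < f q < n.+1%:R^-1).
  by apply: measurable_and; apply: measurable_fun_ltr => //; case: bf.
have cvgE : (\int[mu]_(q in prec_set)
     ((0 < f q < n.+1%:R^-1)%R%:R : R)%:E)%E @[n --> \oo] -->
     (\int[mu]_(q in prec_set) (0%R : R)%:E)%E.
  apply: (@dominated_cvg _ _ _ _ _ _ _ _ (fun=> (1 : R)%:E)) => //.
  - by move=> n; apply/measurable_EFinP; case: (bmeas_bool (mb n)).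
  - move=> q Dq; apply: cvg_near_cst.
    have [fq|fq] := ltP 0 (f q); last by apply: nearW.
    near=> n; rewrite /= ltNge (_ : _ <= _) //; near: n.
    have [k _ kf] := near_infty_natSinv_lt (PosNum fq).
    by exists k => // n /kf /= /ltW.
  - exact: (bmeas_integrable mu (bmeas_cst 1)).
  - by move=> n q Dq; rewrite /= lee_fin normr_nat lern1 leq_b1.
move: cvgE; rewrite integral0 => /fine_cvg; exact.
Unshelve. all: by end_near. Qed.

End BoundedMeasurable.

(** * Integrals over precision and signal, and vanishing disagreement *)

Section SignalIntegral.
Context {R : realType} (X : finType) (mu : probability R R) (c : R).
Hypothesis c0 : 0 <= c.
Implicit Types (f g : R -> bool -> R) (h : R -> bool -> X).

(** The weight [c] is meant to be the probability of a party. The likelihood of the signal is left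
    to the integrand. *)
Definition sint f := c * \sum_(s : bool) \int[mu]_(q in prec_set) f q s.

Definition sbmeas f := forall s, bmeas (f^~ s).

Definition mstrat h :=
  forall s x, measurable_fun prec_set (fun q => h q s == x).

Lemma sbmeasD f g : sbmeas f -> sbmeas g -> sbmeas (fun q s => f q s + g q s).
Proof. by move=> bf bg s; apply: bmeasD; [apply: bf|apply: bg]. Qed.

Lemma sbmeasB f g : sbmeas f -> sbmeas g -> sbmeas (fun q s => f q s - g q s).
Proof. by move=> bf bg s; apply: bmeasB; [apply: bf|apply: bg]. Qed.

Lemma sbmeasZ (k : R) f : sbmeas f -> sbmeas (fun q s => k * f q s).
Proof. by move=> bf s; apply: bmeasM; [apply: bmeas_cst|apply: bf]. Qed.

Lemma sintD f g : sbmeas f -> sbmeas g ->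
  sint (fun q s => f q s + g q s) = sint f + sint g.
Proof.
move=> bf bg; rewrite /sint -mulrDr -big_split /=; congr (_ * _).
apply: eq_bigr => s _; rewrite RintegralD //.
- exact: measurable_prec_set.
- exact: bmeas_integrable (bf s).
- exact: bmeas_integrable (bg s).
Qed.

Lemma sintZ (k : R) f : sbmeas f -> sint (fun q s => k * f q s) = k * sint f.
Proof.
move=> bf; rewrite /sint mulrCA; congr (_ * _); rewrite mulr_sumr.
apply: eq_bigr => s _; rewrite RintegralZl //.
- exact: measurable_prec_set.
- exact: bmeas_integrable (bf s).
Qed.

Lemma sintB f g : sbmeas f -> sbmeas g ->
  sint (fun q s => f q s - g q s) = sint f - sint g.
Proof.
move=> bf bg; rewrite -mulN1r -sintZ // -sintD //; last exact: sbmeasZ.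
by congr (sint _); apply/funext => q; apply/funext => s; rewrite mulN1r.
Qed.

Lemma sint_ge0 f :
  (forall q s, prec_set q -> 0 <= f q s) -> 0 <= sint f.
Proof.
move=> f0; apply: mulr_ge0 => //; apply: sumr_ge0 => s _.
by apply: Rintegral_ge0 => q; exact: f0.
Qed.

Lemma le_sint f g : sbmeas f -> sbmeas g ->
  (forall q s, prec_set q -> f q s <= g q s) -> sint f <= sint g.
Proof.
move=> bf bg fg; rewrite -subr_ge0 -sintB //; apply: sint_ge0 => q s Dq.
by rewrite subr_ge0 fg.
Qed.

Lemma sint_sum (I : Type) (r : seq I) (F : I -> R -> bool -> R) :
  (forall i, sbmeas (F i)) ->
  sint (fun q s => \sum_(i <- r) F i q s) = \sum_(i <- r) sint (F i).
Proof.
move=> bF; elim: r => [|i r IH].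
  rewrite big_nil (_ : (fun q s => _) = (fun q s => 0 * (0 : R))).
    by rewrite sintZ ?mul0r // => s; exact: bmeas_cst.
  by apply/funext => q; apply/funext => s; rewrite big_nil mul0r.
rewrite big_cons -IH -sintD //; last by move=> s; apply: bmeas_sum => j; apply: bF.
by congr (sint _); apply/funext => q; apply/funext => s; rewrite big_cons.
Qed.

Lemma bmeas_strat (F : R -> bool -> X -> R) h :
  (forall s x, bmeas (fun q => F q s x)) -> mstrat h ->
  sbmeas (fun q s => F q s (h q s)).
Proof.
move=> bF mh s.
rewrite (_ : (fun q => _) = fun q => \sum_x (h q s == x)%:R * F q s x).
  by apply: bmeas_sum => x; apply: bmeasM => //; apply: bmeas_bool; apply: mh.
apply/funext => q; rewrite (bigD1 (h q s)) //= eqxx mul1r big1 ?addr0 // => x.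
by rewrite eq_sym => /negbTE ->; rewrite mul0r.
Qed.

Lemma mstrat_comp (Y : eqType) (g : X -> Y) h s (y : Y) : mstrat h ->
  measurable_fun prec_set (fun q => g (h q s) == y).
Proof.
move=> mh.
rewrite (_ : (fun q => _) = fun q =>
    has (fun x => (g x == y) && (h q s == x)) (enum X)); last first.
  apply/funext => q; apply/idP/hasP => [gy|[x _ /andP[gy /eqP ->]] //].
  by exists (h q s); rewrite ?mem_enum ?gy ?eqxx.
elim: (enum X) => [|x r IH] /=; first exact: measurable_cst.
apply: measurable_or => //; apply: measurable_and; first exact: measurable_cst.
exact: mh.
Qed.

Lemma bmeas_family_bound (F : R -> bool -> X -> R) :
  (forall s x, bmeas (fun q => F q s x)) ->
  exists2 C, 0 <= C & forall q s x, prec_set q -> `|F q s x| <= C.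
Proof.
move=> bF; have /choice[M HM] (sx : bool * X) :
    exists M : R, forall q, prec_set q -> `|F q sx.1 sx.2| <= M.
  by case: (bF sx.1 sx.2).
exists (\sum_sx `|M sx|) => [|q s x Dq]; first exact: sumr_ge0.
rewrite (bigD1 (s, x)) //= (le_trans (HM (s, x) q Dq)) //.
by rewrite (le_trans (ler_norm _)) // lerDl sumr_ge0.
Qed.

(** Summing over all pairs of actions gives a bound that does not depend on which actions a strategy
    picks, hence one that is uniform along a sequence of strategies. *)
Lemma cvg_sint_small_gap (F : R -> bool -> X -> R) :
  (forall s x, bmeas (fun q => F q s x)) ->
  sint (fun q s => \sum_(xy : X * X)
    (0 < F q s xy.2 - F q s xy.1 < k.+1%:R^-1)%R%:R) @[k --> \oo] --> (0 : R).
Proof.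
move=> bF.
have bgap s xy : bmeas (fun q => F q s xy.2 - F q s xy.1) by exact: bmeasB.
have bind k xy : sbmeas (fun q s =>
    (0 < F q s xy.2 - F q s xy.1 < k.+1%:R^-1)%R%:R).
  move=> s; apply: bmeas_bool.
  by apply: measurable_and; apply: measurable_fun_ltr => //; case: (bgap s xy).
under eq_fun do rewrite sint_sum //.
have cvg1 (xy : X * X) : sint (fun q s =>
    (0 < F q s xy.2 - F q s xy.1 < k.+1%:R^-1)%R%:R) @[k --> \oo] --> (0 : R).
  suff : sint (fun q s => (0 < F q s xy.2 - F q s xy.1 < k.+1%:R^-1)%R%:R)
      @[k --> \oo] --> c * \sum_(s : bool) (0 : R) by rewrite big1 ?mulr0.
  apply: cvgMr; apply: cvg_big => [|s _]; first exact: add_continuous.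
  exact: cvg_small_gap.
have : \sum_(xy : X * X) sint (fun q s =>
    (0 < F q s xy.2 - F q s xy.1 < k.+1%:R^-1)%R%:R) @[k --> \oo] -->
    \sum_(xy : X * X) (0 : R).
  by apply: cvg_big => //; exact: add_continuous.
by rewrite [\sum_xy 0]big1.
Qed.

(* One level of the lexicographic comparison.  If [h_ n] can do at least as well
   in the limit as [beta], although [beta] is pointwise better wherever the
   previous levels agree, then this level agrees as well, up to vanishing mass. *)
Lemma cvg_disagreement (F : R -> bool -> X -> R) (beta : R -> bool -> X)
    (h_ : nat -> R -> bool -> X) (e_ : nat -> R -> bool -> bool) (l : R) :
  (forall s x, bmeas (fun q => F q s x)) ->
  mstrat beta -> (forall n, mstrat (h_ n)) ->
  (forall n s, measurable_fun prec_set (fun q => e_ n q s)) ->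
  (forall n q s, prec_set q -> e_ n q s -> F q s (h_ n q s) <= F q s (beta q s)) ->
  sint (fun q s => (~~ e_ n q s)%:R) @[n --> \oo] --> (0 : R) ->
  sint (fun q s => F q s (h_ n q s)) @[n --> \oo] --> l ->
  sint (fun q s => F q s (beta q s)) <= l ->
  sint (fun q s => (~~ (e_ n q s && (F q s (h_ n q s) == F q s (beta q s))))%:R)
    @[n --> \oo] --> (0 : R) /\
  l <= sint (fun q s => F q s (beta q s)).
Proof.
move=> bF mbeta mh me le_e cvg_e cvg_h lel.
have [C C0 FC] := bmeas_family_bound bF.
have bb := bmeas_strat bF mbeta.
have bh n := bmeas_strat bF (mh n).
have be n : sbmeas (fun q s => (~~ e_ n q s)%:R : R).
  by move=> s; apply: bmeas_bool; apply: measurable_neg.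
have bgap n : sbmeas (fun q s => (e_ n q s)%:R *
    (F q s (beta q s) - F q s (h_ n q s))).
  move=> s /=; apply: bmeasM; first by apply: bmeas_bool; exact: me.
  by apply: bmeasB; [exact: bb | exact: bh].
pose sm k := sint (fun q s => \sum_(xy : X * X)
    (0 < F q s xy.2 - F q s xy.1 < k.+1%:R^-1)%R%:R).
have bsm k : sbmeas (fun q s => \sum_(xy : X * X)
    (0 < F q s xy.2 - F q s xy.1 < k.+1%:R^-1)%R%:R).
  move=> s; apply: bmeas_sum => xy; apply: bmeas_bool.
  have [? _] : bmeas (fun q => F q s xy.2 - F q s xy.1) by exact: bmeasB.
  by apply: measurable_and; apply: measurable_fun_ltr.
pose B := sint (fun q s => F q s (beta q s)).
pose H n := sint (fun q s => F q s (h_ n q s)).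
pose E n := sint (fun q s => (~~ e_ n q s)%:R).
pose G n := sint (fun q s => (e_ n q s)%:R * (F q s (beta q s) - F q s (h_ n q s))).
have G0 n : 0 <= G n.
  apply: sint_ge0 => q s Dq; case: (boolP (e_ n q s)) => eq; last by rewrite mul0r.
  by rewrite mul1r subr_ge0; exact: le_e.
(* Dropping the points outside [e_ n] from the total gain [B - H n] costs at most [C + C] per unit
   of their mass. *)
have GE n : G n <= B - H n + (C + C) * E n.
  rewrite -sintB // -sintZ // -sintD //; last 2 first.
  - exact: sbmeasB.
  - exact: sbmeasZ.
  apply: le_sint => //; first by apply: sbmeasD; [exact: sbmeasB | exact: sbmeasZ].
  move=> q s Dq; case: (e_ n q s) => /=; first by rewrite mul1r mulr0 addr0.
  have := FC q s (beta q s) Dq; have := FC q s (h_ n q s) Dq.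
  by rewrite !ler_norml => /andP[? ?] /andP[? ?]; lra.
have cvgR : B - H n + (C + C) * E n @[n --> \oo] --> B - l + (C + C) * 0.
  apply: cvgD; first by apply: cvgB => //; exact: cvg_cst.
  by apply: cvgMr.
have lB : l <= B.
  have : 0 <= B - l + (C + C) * 0.
    apply: (@ler_cvg_to _ _ _ _ (fun=> 0) _ _ _ (cvg_cst _) cvgR).
    by apply: nearW => n; apply: le_trans (G0 n) (GE n).
  by rewrite mulr0 addr0 subr_ge0.
split => //.
(* A point of disagreement lies outside [e_ n], or has a gap below [1/(k+1)] and is counted in
   [sm k], or has a larger gap and is bounded as in Markov's inequality by [k+1] times its gap. *)
have key n k : sint (fun q s => (~~ (e_ n q s &&
    (F q s (h_ n q s) == F q s (beta q s))))%:R) <=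
    E n + sm k + k.+1%:R * (B - H n + (C + C) * E n).
  apply: (@le_trans _ _ (E n + sm k + k.+1%:R * G n)); last first.
    by rewrite lerD2l ler_wpM2l.
  rewrite -sintZ // -sintD // -sintD //; last 2 first.
  - exact: sbmeasD.
  - exact: sbmeasZ.
  apply: le_sint.
  - move=> s; apply: bmeas_bool; apply: measurable_neg; apply: measurable_and => //.
    by apply: measurable_fun_eqr; [case: (bh n s) | case: (bb s)].
  - by apply: sbmeasD; [exact: sbmeasD | exact: sbmeasZ].
  move=> q s Dq.
  have sm0 : 0 <= \sum_(xy : X * X)
      (0 < F q s xy.2 - F q s xy.1 < k.+1%:R^-1)%R%:R :> R by exact: sumr_ge0.
  case: (boolP (e_ n q s)) => eq /=; last by rewrite mul0r mulr0 addr0 lerDl.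
  have := le_e n q s Dq eq; rewrite add0r mul1r le_eqVlt.
  case: eqVneq => [->|_ /= gap]; first by rewrite subrr mulr0 addr0.
  rewrite -subr_gt0 in gap.
  have [lt|ge] := ltP (F q s (beta q s) - F q s (h_ n q s)) k.+1%:R^-1.
    rewrite (bigD1 (h_ n q s, beta q s)) //= gap lt /= -addrA lerDl.
    by rewrite addr_ge0 ?sumr_ge0 // mulr_ge0 // ltW.
  rewrite -[leLHS]add0r lerD //.
  rewrite -[leLHS](@mulfV _ (k.+1%:R : R)) ?pnatr_eq0 //.
  by rewrite ler_wpM2l.
have cvg_sm : sm k @[k --> \oo] --> (0 : R) by exact: cvg_sint_small_gap.
apply/cvgrPdist_lt => eps eps0.
(* Since [sm k] does not involve [n], [k] can be fixed first; the other terms of the bound then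
   vanish as [n] grows. *)
have [k smk] : exists k, sm k < eps / 2.
  have e2 : 0 < eps / 2 by rewrite divr_gt0.
  move/cvgrPdist_lt : cvg_sm => /(_ _ e2) [k _ /(_ k (leqnn k))] /=.
  by rewrite sub0r normrN => /(le_lt_trans (ler_norm _)); exists k.
have cvgK : E n + sm k + k.+1%:R * (B - H n + (C + C) * E n) @[n --> \oo] -->
    0 + sm k + k.+1%:R * (B - l + (C + C) * 0).
  apply: cvgD; first by apply: cvgD => //; exact: cvg_cst.
  by apply: cvgMr.
have lim_lt : 0 + sm k + k.+1%:R * (B - l + (C + C) * 0) < eps.
  have -> : B = l by apply/eqP; rewrite eq_le lel lB.
  by rewrite subrr mulr0 addr0 mulr0; lra.
move/cvgrPdist_lt : cvgK => /(_ (eps - (0 + sm k + k.+1%:R * (B - l + (C + C) * 0)))).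
rewrite subr_gt0 => /(_ lim_lt); apply: filterS => n /=.
have kn := key n k; rewrite ltr_norml => /andP[lo _].
rewrite sub0r normrN ger0_norm; last exact: sint_ge0.
by apply: le_lt_trans kn _; lra.
Qed.

End SignalIntegral.

(** * Compactness and lexicographic maximization *)

Section LexicographicMaximum.
Import ArrowAsProduct.

(** Each function is maximized over the maximizers of the previous ones, which form a closed, hence
    compact, part of [K]. *)
Lemma compact_lex_max (T : topologicalType) (R : realType) (K : set T)
    (f1 f2 f3 : T -> R) :
  K !=set0 -> compact K -> closed K ->
  continuous f1 -> continuous f2 -> continuous f3 ->
  exists2 v, K v & forall u, K u ->
    f1 u <= f1 v /\
    (f1 v <= f1 u -> f2 u <= f2 v /\ (f2 v <= f2 u -> f3 u <= f3 v)).
Proof.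
move=> K0 cK clK c1 c2 c3.
have cl_level (f : T -> R) r : continuous f -> closed [set u | f u = r].
  move=> cf; have := @preimage_closed _ _ f [set r] (fun x _ => cf x).
  by apply; exact: closed_eq.
have [v1 /set_mem Kv1 max1] := compact_EVT_max K0 cK (continuous_subspaceT c1).
pose K1 := K `&` [set u | f1 u = f1 v1].
have cK1 : compact K1 by apply: compact_closedI => //; exact: cl_level.
have K10 : K1 !=set0 by exists v1.
have [v2 /set_mem K1v2 max2] := compact_EVT_max K10 cK1 (continuous_subspaceT c2).
pose K2 := K1 `&` [set u | f2 u = f2 v2].
have cK2 : compact K2 by apply: compact_closedI => //; exact: cl_level.
have K20 : K2 !=set0 by exists v2.
have [v3 /set_mem K2v3 max3] := compact_EVT_max K20 cK2 (continuous_subspaceT c3).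
have [[Kv3 e1] e2] := K2v3; rewrite /= in e1 e2.
exists v3 => // u Ku; rewrite e1 e2.
have le1 : f1 u <= f1 v1 by apply: max1; exact/mem_set.
split => // ge1.
have K1u : K1 u by split => //; apply/eqP; rewrite eq_le le1 ge1.
have le2 : f2 u <= f2 v2 by apply: max2; exact/mem_set.
split => // ge2; apply: max3; apply/mem_set; split => //.
by apply/eqP; rewrite eq_le le2 ge2.
Qed.

(** As [T] is finite, uniform balls are neighbourhoods in the product topology, so the second
    hypothesis makes [K] closed; it sits in a box that is compact by Tychonoff's theorem. *)
Lemma approx_set_compact (R : realType) (T : finType) (K : set (T -> R)) (a b : R) :
  (forall u, K u -> forall t, a <= u t <= b) ->
  (forall v, (forall e, 0 < e -> exists2 u, K u & forall t, `|u t - v t| < e) ->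
    K v) ->
  compact K /\ closed K.
Proof.
move=> Kab Kapprox.
have clK : closed K.
  move=> v clv; apply: Kapprox => e e0.
  have : nbhs v [set u : T -> R | forall t, `|u t - v t| < e].
    apply: (@filter_forall _ _ (fun t (u : T -> R) => `|u t - v t| < e) (nbhs v)
      (nbhs_filter v)) => t.
    have := @proj_continuous T (fun=> R) t v.
    move=> /cvgrPdist_lt /(_ _ e0); apply: filterS => u /=.
    by rewrite /proj distrC.
  by move=> /clv [u [Ku uv]]; exists u.
split => //.
apply: (@subclosed_compact _ K [set u : T -> R | forall t, `[a, b]%classic (u t)]).
- exact: clK.
- exact: (@tychonoff T (fun=> R) (fun=> `[a, b]%classic)
    (fun=> @segment_compact R a b)).
- by move=> u Ku t; rewrite /= in_itv /=; exact: Kab.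
Qed.

Section ContinuousOperations.
Context {T : topologicalType} {R : realType} {I : Type}.
Implicit Types (f : T -> R) (F : I -> T -> R).

Lemma continuous_mull (k : R) f : continuous f -> continuous (fun u => k * f u).
Proof. by move=> cf u; apply: cvgMr; exact: cf. Qed.

Lemma continuous_mulr (k : R) f : continuous f -> continuous (fun u => f u * k).
Proof. by move=> cf u; apply: cvgMl; exact: cf. Qed.

Lemma continuous_sum (r : seq I) (p : pred I) F : (forall i, continuous (F i)) ->
  continuous (fun u => \sum_(i <- r | p i) F i u).
Proof. by move=> cF; apply: continuous_big => //; exact: add_continuous. Qed.

Lemma continuous_prod (r : seq I) (p : pred I) F : (forall i, continuous (F i)) ->
  continuous (fun u => \prod_(i <- r | p i) F i u).
Proof. by move=> cF; apply: continuous_big => //; exact: mul_continuous. Qed.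

End ContinuousOperations.

Lemma continuous_coord (R : realType) (T : finType) (t : T) :
  continuous (fun u : T -> R => u t).
Proof. exact: (@proj_continuous T (fun=> R) t). Qed.

End LexicographicMaximum.

(** * Effect of one voter's action on the delegation outcome *)

Section Delegation.
Context {R : realType} {N : nat}.
Implicit Types (a : {ffun 'I_N -> act N}) (i j : 'I_N) (x y : act N).

Definition upd a i x : {ffun 'I_N -> act N} :=
  [ffun j => if j == i then x else a j].

(** A chain that meets [i] within its fuel now ends in a vote for [X], and every other chain is
    unchanged. *)
Lemma resolve_updVote a i x (X : bool) n j :
  (resolve (upd a i x) n j = Some X ->
   resolve (upd a i (Vote N X)) n j = Some X) /\
  (resolve (upd a i (Vote N X)) n j = Some (~~ X) ->
   resolve (upd a i x) n j = Some (~~ X)).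
Proof.
elim: n j => [|n IH] j //=; rewrite !ffunE; case: eqP => [_|_].
  by split=> // -[] {IH}; case: X.
by case: (a j) => //= k; exact: IH.
Qed.

Lemma win_prob_updVote a i x (X : bool) :
  win_prob LD (upd a i x) X <= win_prob LD (upd a i (Vote N X)) X :> R.
Proof.
rewrite /win_prob.
have up : (Defs.tally LD (upd a i x) X <= Defs.tally LD (upd a i (Vote N X)) X)%N.
  rewrite leq_add2r subset_leq_card //; apply/fintype.subsetP => j.
  by rewrite !inE => /eqP /(resolve_updVote a i x X N.+1 j).1 /eqP.
have dn : (Defs.tally LD (upd a i (Vote N X)) (~~ X) <=
           Defs.tally LD (upd a i x) (~~ X))%N.
  rewrite leq_add2r subset_leq_card //; apply/fintype.subsetP => j.
  by rewrite !inE => /eqP /(resolve_updVote a i x X N.+1 j).2 /eqP.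
move: up dn; set t1 := Defs.tally _ _ X; set t2 := Defs.tally _ _ X.
set t3 := Defs.tally _ _ _; set t4 := Defs.tally _ _ _ => t12 t34.
case: (ltnP t4) => h1; first by rewrite (leq_ltn_trans t34 (leq_trans h1 t12)).
case: (ltnP t3) => h2; first by case: (_ == _) => //; lra.
case: eqP => [e1|_]; last by case: (_ == _) => //; lra.
have -> : t2 == t3; last by [].
by rewrite eqn_leq h2 (leq_trans t34) // -e1.
Qed.

(** Reindexing lets the sums for different actions of [i] range over the same profiles, so that they
    can be compared term by term. *)
Lemma big_upd (x y : act N) i (g : 'I_N -> act N -> R) (f : {ffun 'I_N -> act N} -> R) :
  \sum_(a : {ffun 'I_N -> act N} | a i == x) (\prod_(j | j != i) g j (a j)) * f a =
  \sum_(a : {ffun 'I_N -> act N} | a i == y)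
    (\prod_(j | j != i) g j (a j)) * f (upd a i x).
Proof.
rewrite (reindex_onto (fun a => upd a i x) (fun a => upd a i y)) /=; last first.
  move=> a /eqP ax; apply/ffunP => j; rewrite !ffunE.
  by case: eqP => [->|].
apply: eq_big => [a|a _].
  rewrite ffunE eqxx eqxx /=; apply/eqP/eqP => [<-|ay]; first by rewrite !ffunE eqxx.
  by apply/ffunP => j; rewrite !ffunE; case: eqP => [->|].
by congr (_ * _); apply: eq_bigr => j /negbTE ji; rewrite ffunE ji.
Qed.

End Delegation.

(** * Action probabilities as integrals over types *)

Section ActionProbabilities.
Context {R : realType} (N : nat) (pi : R) (P : 'I_N -> party -> R)
        (Q : 'I_N -> probability R R).
Hypothesis P0 : forall i p, 0 <= P i p.
Implicit Types (V : bool -> act N -> R) (h : strategy R N).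

(** The posterior expectation of [V], not divided by the probability of the signal: this keeps it
    affine in [q]. *)
Definition payoff V (q : R) (s : bool) (x : act N) : R :=
  \sum_(w : bool) prior pi w * sig_prob q s w * V w x.

Definition expect V (u : bool -> act N -> R) : R :=
  \sum_(w : bool) prior pi w * \sum_(x : act N) u w x * V w x.

Lemma bmeas_sig_prob s w : bmeas (fun q : R => sig_prob q s w).
Proof.
rewrite /sig_prob; case: (s == w); first exact: bmeas_id.
by apply: bmeasB; [exact: bmeas_cst | exact: bmeas_id].
Qed.

Lemma sig_prob_ge0 (q : R) s w : prec_set q -> 0 <= sig_prob q s w.
Proof.
rewrite /prec_set /= in_itv /= /sig_prob => /andP[q0 q1].
by case: (s == w); lra.
Qed.

Lemma sig_prob_le1 (q : R) s w : prec_set q -> sig_prob q s w <= 1.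
Proof.
rewrite /prec_set /= in_itv /= /sig_prob => /andP[q0 q1].
by case: (s == w); lra.
Qed.

Lemma bmeas_payoff V s x : bmeas (fun q => payoff V q s x).
Proof.
apply: bmeas_sum => w; apply: bmeasM; last exact: bmeas_cst.
by apply: bmeasM; [exact: bmeas_cst | exact: bmeas_sig_prob].
Qed.

Definition mstrategy h := forall p, mstrat (h p).

Lemma valid_mstrategy (M : mech N) i h : valid_strategy M i h -> mstrategy h.
Proof.
move=> [_ mh] p s x mD; apply: (measurable_fun_bool true) => //.
rewrite (_ : _ `&` _ = [set q | prec_set q /\ h p q s = x]) //.
by apply/seteqP; split=> q /= [Dq /eqP hq].
Qed.

Lemma mstrategy_measurable h p s x : mstrategy h ->
  measurable [set q | prec_set q /\ h p q s = x].
Proof.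
move=> mh; have := mh p s x measurable_prec_set [set true] I.
rewrite (_ : _ `&` _ = [set q | prec_set q /\ h p q s = x]) //.
by apply/seteqP; split=> q /= [Dq /eqP hq].
Qed.

Lemma sbmeas_choice h p w x : mstrategy h ->
  sbmeas (fun q s => sig_prob q s w * (h p q s == x)%:R).
Proof.
by move=> mh s; apply: bmeasM; [exact: bmeas_sig_prob | apply: bmeas_bool; exact: mh].
Qed.

Lemma act_probE j h w x : mstrategy h ->
  act_prob P Q j h w x =
  \sum_p sint (Q j) (P j p) (fun q s => sig_prob q s w * (h p q s == x)%:R).
Proof.
move=> mh; apply: eq_bigr => p _; congr (_ * _).
have bi s := bmeas_integrable (Q j) (sbmeas_choice p w x mh s).
rewrite (RintegralD measurable_prec_set (bi w) (bi (~~ w))).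
by rewrite big_bool /=; case: w bi => bi //=; rewrite addrC.
Qed.

Lemma act_prob_ge0 j h w x : mstrategy h -> 0 <= act_prob P Q j h w x.
Proof.
move=> mh; rewrite act_probE //; apply: sumr_ge0 => p _; apply: sint_ge0 => // q s Dq.
by rewrite mulr_ge0 // sig_prob_ge0.
Qed.

Lemma act_prob_bound j h w x : \sum_p P j p = 1 -> mstrategy h ->
  act_prob P Q j h w x <= 2.
Proof.
move=> P1 mh; have -> : 2 = \sum_p P j p * \sum_(s : bool) 1.
  by rewrite -mulr_suml P1 mul1r big_bool /=; lra.
rewrite act_probE //; apply: ler_sum => p _; rewrite ler_wpM2l //.
apply: ler_sum => s _.
apply: (@le_trans _ _ (\int[Q j]_(q in prec_set) 1)).
  apply: le_Rintegral.
  - exact: measurable_prec_set.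
  - exact: bmeas_integrable (sbmeas_choice p w x mh s).
  - exact: bmeas_integrable (bmeas_cst 1).
  - move=> q Dq; rewrite -[leRHS]mulr1.
    by apply: ler_pM; rewrite ?sig_prob_ge0 ?sig_prob_le1 // lern1 leq_b1.
rewrite Rintegral_cst; last exact: measurable_prec_set.
rewrite mul1r; have := probability_le1 (Q j) measurable_prec_set.
move=> le1; rewrite -lee_fin fineK // ge0_fin_numE //.
by rewrite (le_lt_trans le1) // ltry.
Qed.

Lemma sum_choice (x : act N) (f : act N -> R) : \sum_y f y * (x == y)%:R = f x.
Proof.
rewrite (bigD1 x) //= eqxx mulr1 big1 ?addr0 // => y.
by rewrite eq_sym => /negbTE ->; rewrite mulr0.
Qed.

(** Turns a linear functional of the action probabilities into an integral over types, where
    strategies can be compared pointwise. *)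
Lemma expect_act_prob V j h : mstrategy h ->
  expect V (act_prob P Q j h) =
  \sum_p sint (Q j) (P j p) (fun q s => payoff V q s (h p q s)).
Proof.
move=> mh; rewrite /expect.
have bc p w x := sbmeas_choice p w x mh.
transitivity (\sum_w \sum_x \sum_p sint (Q j) (P j p) (fun q s =>
    prior pi w * V w x * (sig_prob q s w * (h p q s == x)%:R))).
  apply: eq_bigr => w _; rewrite mulr_sumr; apply: eq_bigr => x _.
  rewrite act_probE // mulr_suml mulr_sumr; apply: eq_bigr => p _.
  by rewrite sintZ; [ring | exact: bc].
under eq_bigr do rewrite exchange_big.
rewrite exchange_big; apply: eq_bigr => p _.
have bcZ w x : sbmeas (fun q s =>
    prior pi w * V w x * (sig_prob q s w * (h p q s == x)%:R)).
  by apply: sbmeasZ; exact: bc.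
rewrite (eq_bigr _ (fun w _ => esym (sint_sum _ _ _ (bcZ w)))) -sint_sum; last first.
  by move=> w s; apply: bmeas_sum => x; exact: bcZ.
congr (sint _ _ _); apply/funext => q; apply/funext => s; apply: eq_bigr => w _.
under eq_bigr do rewrite mulrA.
by rewrite sum_choice mulrAC.
Qed.

(** The partisan terms cancel, and the integrands for independents differ by at most 1, only where
    [e] fails. *)
Lemma act_prob_diff j h h' (e : R -> bool -> bool) w x :
  mstrategy h -> mstrategy h' ->
  (forall p, p != PI -> h p = h' p) ->
  (forall s, measurable_fun prec_set (e^~ s)) ->
  (forall q s, prec_set q -> e q s -> h PI q s = h' PI q s) ->
  `|act_prob P Q j h w x - act_prob P Q j h' w x| <=
  sint (Q j) (P j PI) (fun q s => (~~ e q s)%:R).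
Proof.
move=> mh mh' hh' me eh; rewrite !act_probE // (bigD1 PI) //=.
rewrite [in X in _ - X](bigD1 PI) //=.
rewrite (eq_bigr (fun p => sint (Q j) (P j p)
    (fun q s => sig_prob q s w * (h' p q s == x)%:R))); last first.
  by move=> p /hh' ->.
rewrite opprD addrACA subrr addr0 -sintB; try exact: sbmeas_choice.
have be : sbmeas (fun q s => (~~ e q s)%:R : R).
  by move=> s; apply: bmeas_bool; exact: measurable_neg.
have bd : sbmeas (fun q s => sig_prob q s w * (h PI q s == x)%:R -
    sig_prob q s w * (h' PI q s == x)%:R).
  by apply: sbmeasB; exact: sbmeas_choice.
have pt q s : prec_set q -> `|sig_prob q s w * (h PI q s == x)%:R -
    sig_prob q s w * (h' PI q s == x)%:R| <= (~~ e q s)%:R.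
  move=> Dq; have s0 := sig_prob_ge0 s w Dq; have s1 := sig_prob_le1 s w Dq.
  case: (boolP (e q s)) => [/(eh _ _ Dq) ->|_ /=]; first by rewrite subrr normr0.
  rewrite ler_norml.
  by case: (h PI q s == x); case: (h' PI q s == x);
    rewrite ?mulr1 ?mulr0 ?subrr ?subr0 ?sub0r; lra.
rewrite ler_norml; apply/andP; split; last first.
  by apply: le_sint => // q s Dq; rewrite (le_trans (ler_norm _)) // pt.
rewrite -mulN1r -sintZ //; apply: le_sint => //; first exact: sbmeasZ.
by move=> q s Dq; have := pt q s Dq; rewrite ler_norml mulN1r => /andP[].
Qed.

End ActionProbabilities.

(** * Welfare as a multilinear function of action probabilities *)

Section Welfare.
Context {R : realType} (N : nat) (pi : R) (P : 'I_N -> party -> R)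
        (Q : 'I_N -> probability R R).
Local Notation index := ('I_N * bool * act N)%type.
Implicit Types (u : index -> R) (i : 'I_N) (sigma tau : 'I_N -> strategy R N).

(** The probability of a correct outcome in state [w] if [i] plays [x] and the others follow [u]; it
    is also the coefficient of [u (i, w, x)] in the welfare conditional on [w]. *)
Definition pivot i u (w : bool) (x : act N) : R :=
  \sum_(a : {ffun 'I_N -> act N} | a i == x)
    (\prod_(j | j != i) u (j, w, a j)) * win_prob LD a w.

(** Defined on all vectors, since the maximizer is at first only a limit of vectors of
    strategies. *)
Definition vwelfare u : R :=
  \sum_(w : bool) prior pi w *
    \sum_(a : {ffun 'I_N -> act N})
       (\prod_(j : 'I_N) u (j, w, a j)) * win_prob LD a w.

Definition act_probs sigma : index -> R :=
  fun t => act_prob P Q t.1.1 (sigma t.1.1) t.1.2 t.2.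

Definition set_coord u i (b : bool -> act N -> R) : index -> R :=
  fun t => if t.1.1 == i then b t.1.2 t.2 else u t.

Lemma vwelfare_act_probs sigma :
  welfare pi P Q LD sigma = vwelfare (act_probs sigma).
Proof. by []. Qed.

Lemma vwelfare_pivot i u :
  vwelfare u = expect pi (pivot i u) (fun w x => u (i, w, x)).
Proof.
apply: eq_bigr => w _; congr (_ * _).
rewrite (partition_big (fun a : {ffun 'I_N -> act N} => a i) xpredT) //=.
apply: eq_bigr => x _; rewrite /pivot mulr_sumr; apply: eq_bigr => a /eqP ax.
by rewrite (bigD1 i) //= ax mulrA.
Qed.

Lemma pivot_set_coord i u b : pivot i (set_coord u i b) = pivot i u.
Proof.
apply/funext => w; apply/funext => x; apply: eq_bigr => a _; congr (_ * _).
by apply: eq_bigr => j /negbTE ji; rewrite /set_coord /= ji.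
Qed.

Definition likelihood (q : R) (s : bool) : R :=
  prior pi true * sig_prob q s true + prior pi false * sig_prob q s false.

(** Independents share the welfare objective: up to the positive factor [likelihood q s], their
    interim utility is the payoff against the coefficients of the welfare. *)
Lemma interim_EU_PI sigma i q s x :
  interim_EU pi P Q LD sigma i PI q s x =
  payoff pi (pivot i (act_probs sigma)) q s x / likelihood q s.
Proof.
rewrite /interim_EU /payoff mulr_suml; apply: eq_bigr => w _.
rewrite /posterior -/(likelihood q s) mulrAC; congr (_ * _ * _).
apply: eq_bigr => a _; congr (_ * _); rewrite /exp_util /util.
by case: w; rewrite mulr1 mulr0 ?addr0 ?add0r.
Qed.

Lemma payoffD (V V' : bool -> act N -> R) q s x :
  payoff pi (fun w z => V w z + V' w z) q s x =
  payoff pi V q s x + payoff pi V' q s x.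
Proof. by rewrite -big_split; apply: eq_bigr => w _; rewrite mulrDr. Qed.

Lemma payoff_sum (I : finType) (V : I -> bool -> act N -> R) q s x :
  payoff pi (fun w z => \sum_k V k w z) q s x = \sum_k payoff pi (V k) q s x.
Proof.
by rewrite /payoff exchange_big; apply: eq_bigr => w _; rewrite mulr_sumr.
Qed.

Lemma payoff_affine (V : bool -> act N -> R) s x :
  exists A B, forall q, payoff pi V q s x = A + B * q.
Proof.
rewrite /payoff; case: s.
  exists (prior pi false * V false x).
  exists (prior pi true * V true x - prior pi false * V false x) => q.
  by rewrite big_bool /sig_prob /=; ring.
exists (prior pi true * V true x).
exists (prior pi false * V false x - prior pi true * V true x) => q.
by rewrite big_bool /sig_prob /=; ring.
Qed.

Hypothesis pi01 : 0 < pi < 1.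

Lemma prior_gt0 w : 0 < prior pi w.
Proof. by rewrite /prior; case: w; move: pi01 => /andP[? ?]; lra. Qed.

Lemma likelihood_gt0 q s : prec_set q -> 0 < likelihood q s.
Proof.
rewrite /prec_set /= in_itv /= => /andP[q0 q1].
have := prior_gt0 true; have := prior_gt0 false; rewrite /likelihood /sig_prob.
by case: s => /= ? ?; nra.
Qed.

(** * Reduction of the other mechanisms to liquid democracy *)

Section Reduction.
Variables (M : mech N) (sigma : 'I_N -> strategy R N).

Definition reduce (x : act N) : act N := if x is DelStar b then Vote N b else x.

Lemma resolve_reduce (a : 'I_N -> act N) n i :
  resolve a n i = resolve (fun j => reduce (a j)) n i.
Proof. by elim: n i => //= n IH i; case: (a i) => //=. Qed.

(** The votes of [a*] and [b*] themselves add the same number to both tallies and cancel in the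
    comparison. *)
Lemma win_prob_reduce (a : {ffun 'I_N -> act N}) X :
  win_prob M a X = win_prob LD [ffun j => reduce (a j)] X :> R.
Proof.
have tallyE b : Defs.tally M a b =
    (Defs.tally LD [ffun j => reduce (a j)] b + extra_votes M)%N.
  rewrite /Defs.tally /= addn0; congr (_ + _)%N; apply: eq_card => i.
  have voteE : vote_of a i = vote_of [ffun j => reduce (a j)] i.
    rewrite /vote_of resolve_reduce; congr (resolve _ _ _).
    by apply/funext => j; rewrite ffunE.
  by apply/idP/idP; rewrite !inE /= voteE.
by rewrite /win_prob !tallyE ltn_add2r eqn_add2r.
Qed.

Lemma allowed_reduce i x : allowed M i x -> allowed LD i (reduce x).
Proof.
case: M => [||J]; case: x => //= j /andP[iJ jJ].
by apply: contraNneq iJ => <-.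
Qed.

Lemma reduce_partisan_act i b : reduce (partisan_act M i b) = Vote N b.
Proof. by rewrite /partisan_act; case: M => //= J; case: ifP. Qed.

Definition reduced : 'I_N -> strategy R N := fun i p q s => reduce (sigma i p q s).

Hypothesis vsigma : valid_profile M sigma.

Lemma act_prob_reduced i w y :
  act_prob P Q i (reduced i) w y =
  \sum_(x | reduce x == y) act_prob P Q i (sigma i) w x.
Proof.
have ms := valid_mstrategy (vsigma i).
have redE p q s z : (reduced i p q s == z)%:R =
    \sum_(x | reduce x == z) (sigma i p q s == x)%:R :> R.
  rewrite -[LHS](sum_choice (sigma i p q s) (fun x => (reduce x == z)%:R)).
  rewrite [RHS]big_mkcond; apply: eq_bigr => x _.
  by case: (reduce x == z); rewrite ?mul1r ?mul0r.
have mr : mstrategy (reduced i).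
  by move=> p s z; exact: (mstrat_comp reduce s z (ms p)).
rewrite act_probE //.
under [RHS]eq_bigr do rewrite act_probE //.
rewrite exchange_big; apply: eq_bigr => p _.
rewrite -big_filter -sint_sum; last by move=> x; exact: sbmeas_choice.
congr (sint _ _ _); apply/funext => q; apply/funext => s.
by rewrite redE mulr_sumr big_filter.
Qed.

End Reduction.
End Welfare.

(** * Sincere profiles, dominance and best replies *)

Section Equilibrium.
Context {R : realType} (N : nat) (pi : R) (P : 'I_N -> party -> R)
        (Q : 'I_N -> probability R R).
Local Notation index := ('I_N * bool * act N)%type.
Implicit Types (u : index -> R) (i : 'I_N) (sigma tau : 'I_N -> strategy R N).
Hypothesis pi01 : 0 < pi < 1.
Hypothesis P0 : forall i p, 0 <= P i p.
Hypothesis P1 : forall i, \sum_(p : party) P i p = 1.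

Lemma welfare_reduced (M : mech N) sigma : valid_profile M sigma ->
  welfare pi P Q M sigma = vwelfare pi (act_probs P Q (reduced sigma)).
Proof.
move=> vs; apply: eq_bigr => w _; congr (_ * _).
pose red (a : {ffun 'I_N -> act N}) : {ffun 'I_N -> act N} :=
  [ffun j => reduce (a j)].
(* Profiles are grouped by their reduction [b]; expanding the product of the reduced probabilities
   gives the sum over exactly this group. *)
rewrite (partition_big red xpredT) //=; apply: eq_bigr => b _.
rewrite /act_probs /=; under [in RHS]eq_bigr do rewrite (act_prob_reduced P Q vs).
rewrite bigA_distr_big_dep /= mulr_suml; apply: eq_big => [a|a /eqP <-].
  apply/eqP/familyP => [<- j|rb]; first by rewrite unfold_in ffunE.
  by apply/ffunP => j; rewrite ffunE; exact/eqP/rb.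
by rewrite (win_prob_reduce M).
Qed.

Definition pvote (p : party) : act N := if p is PA then Vote N true else Vote N false.

(** Only partisans are constrained; independents may play any measurable allowed strategy,
    thresholds included or not. *)
Definition sincere i (h : strategy R N) :=
  valid_strategy LD i h /\ forall p, p != PI -> h p = (fun _ _ => pvote p).

Lemma reduced_sincere (M : mech N) sigma i : valid_profile M sigma ->
  (forall i, threshold_strategy M i (sigma i)) -> sincere i (reduced sigma i).
Proof.
move=> vs ts; split.
  split=> [p q s|p s x]; first exact: allowed_reduce ((vs i).1 p q s).
  apply: (@mstrategy_measurable _ _ (reduced sigma i)) => {}p {}s {}x.
  exact: (mstrat_comp (@reduce N) s x (valid_mstrategy (vs i) p)).
have [tA [tB _]] := ts i.
case=> [_|_|/eqP //]; apply/funext => q; apply/funext => s; rewrite /reduced.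
  by rewrite tA reduce_partisan_act.
by rewrite tB reduce_partisan_act.
Qed.

Lemma act_probs_ge0 (M : mech N) tau t : valid_profile M tau -> 0 <= act_probs P Q tau t.
Proof. by move=> vt; apply: act_prob_ge0 => //; exact: valid_mstrategy (vt _). Qed.

Lemma posterior_ge0 q s w : prec_set q -> 0 <= posterior pi q s w.
Proof.
move=> Dq; rewrite divr_ge0 //; last by rewrite ltW // (likelihood_gt0 pi01).
by rewrite mulr_ge0 ?sig_prob_ge0 // ltW // prior_gt0.
Qed.

Lemma interim_EU_partisan tau i p q s x : valid_profile LD tau -> prec_set q ->
  p != PI ->
  interim_EU pi P Q LD tau i p q s x <= interim_EU pi P Q LD tau i p q s (pvote p).
Proof.
move=> vt Dq pI; apply: ler_sum => w _; rewrite ler_wpM2l ?posterior_ge0 //.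
pose g j := act_prob P Q j (tau j) w.
pose f (a : {ffun 'I_N -> act N}) : R := exp_util LD p a w.
rewrite [leLHS](big_upd x (pvote p) i g f) [leRHS](big_upd (pvote p) (pvote p) i g f).
apply: ler_sum => a _; rewrite ler_wpM2l //.
  by apply: prodr_ge0 => j _; exact: (act_probs_ge0 (j, w, a j) vt).
rewrite /f /exp_util /util; case: p pI {f} => [_|_|/eqP //] /=;
  rewrite ?mulr1 ?mulr0 ?addr0 ?add0r; exact: win_prob_updVote.
Qed.

(** The vectors [(f t, g t)] lie in a plane, so at most two of them span all the others, and a
    vector orthogonal to these is orthogonal to all. *)
Lemma spanning_pair (T : Type) (A : set T) (f g : T -> R) : A !=set0 ->
  exists t : T * T, [/\ A t.1, A t.2 & forall a b : R,
    a * f t.1 + b * g t.1 = 0 -> a * f t.2 + b * g t.2 = 0 ->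
    forall z, A z -> a * f z + b * g z = 0].
Proof.
move=> [t0 At0].
have [[t1 [t2 [A1 A2 det]]]|nodet] := pselect (exists t1 t2,
    [/\ A t1, A t2 & f t1 * g t2 - g t1 * f t2 != 0]).
  exists (t1, t2); split => //= a b e1 e2 z Az.
  have a0 : a = 0.
    apply: (mulIf det); rewrite mul0r.
    have -> : a * (f t1 * g t2 - g t1 * f t2) =
      g t2 * (a * f t1 + b * g t1) - g t1 * (a * f t2 + b * g t2) by ring.
    by rewrite e1 e2; ring.
  have b0 : b = 0.
    apply: (mulIf det); rewrite mul0r.
    have -> : b * (f t1 * g t2 - g t1 * f t2) =
      f t1 * (a * f t2 + b * g t2) - f t2 * (a * f t1 + b * g t1) by ring.
    by rewrite e1 e2; ring.
  by rewrite a0 b0 !mul0r addr0.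
(* All the vectors are now parallel, so any nonzero one spans; it is sought first through [f], then
   through [g]. *)
have para t1 t2 : A t1 -> A t2 -> f t1 * g t2 = g t1 * f t2.
  move=> A1 A2; apply/eqP; rewrite -subr_eq0; apply: contra_notT nodet => det.
  by exists t1, t2.
have [[t1 A1 f1]|f0] := pselect (exists2 t, A t & f t != 0).
  exists (t1, t1); split => //= a b e1 _ z Az; apply: (mulIf f1); rewrite mul0r.
  have -> : (a * f z + b * g z) * f t1 = a * f z * f t1 + b * (f t1 * g z) by ring.
  rewrite para //; have -> : a * f z * f t1 + b * (g t1 * f z) =
    f z * (a * f t1 + b * g t1) by ring.
  by rewrite e1 mulr0.
have {}f0 z : A z -> f z = 0.
  by move=> Az; apply/eqP; apply: contra_notT f0 => fz; exists z.
have [[t1 A1 g1]|g0] := pselect (exists2 t, A t & g t != 0).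
  exists (t1, t1); split => //= a b; rewrite f0 // mulr0 add0r => /eqP.
  rewrite mulf_eq0 (negbTE g1) orbF => /eqP -> _ z Az.
  by rewrite f0 // mulr0 mul0r addr0.
exists (t0, t0); split => //= a b _ _ z Az; rewrite f0 //.
have [->|gz] := eqVneq (g z) 0; first by rewrite !mulr0 addr0.
by exfalso; apply: g0; exists z.
Qed.

Lemma valid_profile_exists : (valid_profile LD : set ('I_N -> strategy R N)) !=set0.
Proof.
exists (fun _ _ _ _ => Abst) => i; split => // p s x.
apply: (@mstrategy_measurable _ _ (fun _ _ _ => Abst) p s x) => {}p {}s {}x.
exact: measurable_cst.
Qed.

(** Weak dominance for an independent, without the positive normalization of the posterior. *)
Definition vdominates i q s x y :=
  (forall tau, valid_profile LD tau ->
     payoff pi (pivot i (act_probs P Q tau)) q s x <=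
     payoff pi (pivot i (act_probs P Q tau)) q s y) /\
  (exists2 tau, valid_profile LD tau &
     payoff pi (pivot i (act_probs P Q tau)) q s x <
     payoff pi (pivot i (act_probs P Q tau)) q s y).

(* The payoff differences between two actions span a plane at most, so summing
   the payoffs against two suitable profiles for each pair of actions makes
   dominance strict. *)
Lemma dominance_functional i : exists Phi : bool -> act N -> R,
  forall q s x y, vdominates i q s x y -> payoff pi Phi q s x < payoff pi Phi q s y.
Proof.
pose D tau w (xy : act N * act N) := pivot i (act_probs P Q tau) w xy.2 -
  pivot i (act_probs P Q tau) w xy.1.
have /choice[t tP] (xy : act N * act N) := @spanning_pair _ (valid_profile LD)
  (fun tau => D tau true xy) (fun tau => D tau false xy) valid_profile_exists.
exists (fun w z => \sum_xy (pivot i (act_probs P Q (t xy).1) w z +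
  pivot i (act_probs P Q (t xy).2) w z)) => q s x y [le_all [tau vtau lt_tau]].
rewrite !payoff_sum.
have step xy : payoff pi (fun w z => pivot i (act_probs P Q (t xy).1) w z +
    pivot i (act_probs P Q (t xy).2) w z) q s x <=
  payoff pi (fun w z => pivot i (act_probs P Q (t xy).1) w z +
    pivot i (act_probs P Q (t xy).2) w z) q s y.
  by have [v1 v2 _] := tP xy; rewrite !payoffD lerD // le_all.
rewrite (bigD1 (x, y)) //= [ltRHS](bigD1 (x, y)) //= ltr_leD //; last first.
  by apply: ler_sum => xy _; exact: step.
have [v1 v2 span] := tP (x, y).
have diffE z : payoff pi (pivot i (act_probs P Q z)) q s y -
    payoff pi (pivot i (act_probs P Q z)) q s x =
    prior pi true * sig_prob q s true * D z true (x, y) +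
    prior pi false * sig_prob q s false * D z false (x, y).
  by rewrite /payoff !big_bool /D /=; ring.
have l1 := le_all _ v1; have l2 := le_all _ v2.
(* Equality of the sums forces equality at both spanning profiles, hence at every profile, against
   the strict gain at [tau]. *)
rewrite !payoffD lt_neqAle lerD // andbT; apply/negP => /eqP e.
move: lt_tau; rewrite -subr_gt0 diffE (span _ _ _ _ _ vtau) ?ltxx //;
  rewrite -diffE; lra.
Qed.

(** * Lexicographic best replies and their thresholds *)

Section BestReply.
Variables (V1 V2 : bool -> act N -> R) (i : 'I_N).

(** Written as a state-independent [V], so that the last tie-break is a [payoff] like the first two
    criteria. *)
Definition act_rank (w : bool) (x : act N) : R := (enum_rank x)%:R.

Definition best (q : R) (s : bool) : act N :=
  [arg max_(x > Abst | allowed LD i x)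
    ((payoff pi V1 q s x, (payoff pi V2 q s x, payoff pi act_rank q s x))
       : R *l (R *l R))]%O.

Lemma bestP q s : allowed LD i (best q s) /\ forall x, allowed LD i x ->
  payoff pi V1 q s x <= payoff pi V1 q s (best q s) /\
  (payoff pi V1 q s (best q s) <= payoff pi V1 q s x ->
   payoff pi V2 q s x <= payoff pi V2 q s (best q s) /\
   (payoff pi V2 q s (best q s) <= payoff pi V2 q s x ->
    payoff pi act_rank q s x <= payoff pi act_rank q s (best q s))).
Proof.
rewrite /best; case: Order.TotalTheory.arg_maxP => // b ab bmax; split=> // x ax.
have /andP[-> /implyP h] : (payoff pi V1 q s x <= payoff pi V1 q s b) &&
  ((payoff pi V1 q s b <= payoff pi V1 q s x) ==>
   ((payoff pi V2 q s x <= payoff pi V2 q s b) &&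
    ((payoff pi V2 q s b <= payoff pi V2 q s x) ==>
     (payoff pi act_rank q s x <= payoff pi act_rank q s b)))) := bmax x ax.
by split=> // /h /andP[-> /implyP].
Qed.

Lemma payoff_act_rank q s x :
  payoff pi act_rank q s x = likelihood pi q s * (enum_rank x)%:R.
Proof. by rewrite /payoff big_bool /act_rank /likelihood /=; ring. Qed.

Lemma payoff_act_rank_inj q s x y : prec_set q ->
  payoff pi act_rank q s x = payoff pi act_rank q s y -> x = y.
Proof.
move=> Dq; rewrite !payoff_act_rank => /mulfI.
rewrite gt_eqF ?(likelihood_gt0 pi01) // => /(_ isT) /eqP.
by rewrite eqr_nat => /eqP /val_inj /enum_rank_inj.
Qed.

(** A positive slope would put the value at [q] below the one at [q2], a negative slope below the
    one at [q1]; both would make it negative. *)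
Lemma affine_flat (A B q1 q q2 : R) : q1 < q -> q < q2 ->
  A + B * q1 <= 0 -> A + B * q2 <= 0 -> 0 <= A + B * q ->
  [/\ A + B * q1 = 0, A + B * q2 = 0 & A + B * q = 0].
Proof.
move=> lt1 lt2 l1 l2 l.
have B0 : B = 0.
  by apply/eqP; rewrite eq_le; apply/andP; split; nra.
by rewrite B0 !mul0r !addr0 in l1 l2 l *; split; lra.
Qed.

(** The gain from the common action at [q1] and [q2] to the best one at [q] is affine in the
    precision, nonpositive at the ends and nonnegative at [q]. It vanishes at all three points,
    which passes the comparison to the next criterion; the ranking then identifies the actions. *)
Lemma best_convex s q1 q q2 : prec_set q1 -> prec_set q2 -> q1 < q -> q < q2 ->
  best q1 s = best q2 s -> best q s = best q1 s.
Proof.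
move=> D1 D2 lt1 lt2 e12.
have Dq : prec_set q.
  by move: D1 D2; rewrite /prec_set /= !in_itv /= => /andP[? ?] /andP[? ?]; lra.
have [al1 m1] := bestP q1 s; have [_ m2] := bestP q2 s; have [alq mq] := bestP q s.
have {m1}[m11 m12] := m1 _ alq; have {m2}[m21 m22] := m2 _ alq.
have {mq}[mq1 mq2] := mq _ al1; rewrite -e12 in m21 m22.
move: (best q s) (best q1 s) m11 m12 m21 m22 mq1 mq2 => y x.
have flat V : payoff pi V q1 s y <= payoff pi V q1 s x ->
    payoff pi V q2 s y <= payoff pi V q2 s x ->
    payoff pi V q s x <= payoff pi V q s y ->
    [/\ payoff pi V q1 s x <= payoff pi V q1 s y,
        payoff pi V q2 s x <= payoff pi V q2 s y,
        payoff pi V q s y <= payoff pi V q s x &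
        payoff pi V q s x = payoff pi V q s y].
  have [A [B E]] := payoff_affine pi V s x; have [A' [B' E']] := payoff_affine pi V s y.
  rewrite !E !E' => l1 l2 l.
  have := @affine_flat (A' - A) (B' - B) q1 q q2 lt1 lt2.
  by case=> [|||h1 h2 h]; [lra|lra|lra|split; lra].
move=> m11 m12 m21 m22 mq1 mq2.
have [f1 f2 f3 _] := flat _ m11 m21 mq1.
have [m13 m14] := m12 f1; have [m23 m24] := m22 f2; have [mq3 mq4] := mq2 f3.
have [g1 g2 g3 _] := flat _ m13 m23 mq3.
have [_ _ _ /payoff_act_rank_inj -> //] := flat _ (m14 g1) (m24 g2) (mq4 g3).
Qed.

Definition best_strategy : strategy R N :=
  fun p q s => if p is PI then best q s else pvote p.

(** By [best_convex], each action is played on an interval of precisions. *)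
Lemma best_mstrat : mstrat best.
Proof.
move=> s x mD; apply: (measurable_fun_bool true) => //.
apply: is_interval_measurable => q1 q2 [D1 /eqP b1] [D2 /eqP b2] q /andP[l1 l2].
move: l1; rewrite le_eqVlt => /predU1P[<-|l1]; first by split=> //; exact/eqP.
move: l2; rewrite le_eqVlt => /predU1P[->|l2]; first by split=> //; exact/eqP.
split; last by apply/eqP; rewrite (@best_convex s q1 q q2) // b1 b2.
by move: D1 D2; rewrite /prec_set /= !in_itv /= => /andP[? ?] /andP[? ?]; lra.
Qed.

Lemma best_strategy_sincere : sincere i best_strategy.
Proof.
split; last by case=> [||/eqP].
split=> [p q s|p s x]; first by case: p => //; case: (bestP q s).
apply: mstrategy_measurable; case=> {}s {}x; try exact: measurable_cst.
exact: best_mstrat.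
Qed.

Lemma best_strategy_threshold : threshold_strategy LD i best_strategy.
Proof. by split=> //; split=> // s q1 q q2; exact: best_convex. Qed.

End BestReply.
End Equilibrium.

(** * Existence of an equilibrium attaining the maximum *)

Section Existence.
Context {R : realType} (N : nat) (pi : R) (P : 'I_N -> party -> R)
        (Q : 'I_N -> probability R R).
Local Notation index := ('I_N * bool * act N)%type.
Implicit Types (u : index -> R) (i : 'I_N) (sigma tau : 'I_N -> strategy R N).
Hypothesis pi01 : 0 < pi < 1.
Hypothesis P0 : forall i p, 0 <= P i p.
Hypothesis P1 : forall i, \sum_(p : party) P i p = 1.

(** The closure, for the sup norm on the finite index set, of the vectors of sincere profiles. *)
Definition attainable : set (index -> R) := fun u => forall e, 0 < e ->
  exists2 sigma, (forall i, sincere i (sigma i)) &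
    forall t, `|act_probs P Q sigma t - u t| < e.

Lemma attainable_act_probs sigma :
  (forall i, sincere i (sigma i)) -> attainable (act_probs P Q sigma).
Proof. by move=> gs e e0; exists sigma => // t; rewrite subrr normr0. Qed.

Lemma attainable_bound u t : attainable u -> -1 <= u t <= 3.
Proof.
move=> /(_ 1 ltr01) [sigma gs /(_ t)].
have ms := valid_mstrategy (gs t.1.1).1.
have := act_prob_ge0 Q P0 t.1.1 t.1.2 t.2 ms.
have := act_prob_bound Q P0 t.1.2 t.2 (P1 t.1.1) ms.
rewrite -/(act_probs P Q sigma t) ltr_norml => ? ? /andP[? ?].
by apply/andP; split; lra.
Qed.

Lemma attainable_approx v :
  (forall e, 0 < e -> exists2 u, attainable u & forall t, `|u t - v t| < e) ->
  attainable v.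
Proof.
move=> av e e0; have e2 : 0 < e / 2 by rewrite divr_gt0.
have [u au uv] := av _ e2; have [sigma gs su] := au _ e2.
exists sigma => // t; rewrite (splitr e).
rewrite (_ : _ - _ = act_probs P Q sigma t - u t + (u t - v t)); last by ring.
by rewrite (le_lt_trans (ler_normD _ _)) // ltrD.
Qed.

Lemma attainable_set_coord u i h : attainable u -> sincere i h ->
  attainable (set_coord u i (act_prob P Q i h)).
Proof.
move=> au gh e e0; have [sigma gs su] := au _ e0.
exists (fun j => if j == i then h else sigma j) => [j|t].
  by case: eqP => [->|_].
rewrite /set_coord /act_probs; case: eqP => [->|_]; first by rewrite subrr normr0.
exact: su.
Qed.

(** Separable across voters: a unilateral change affects only the term of the deviator, so one
    function on vectors breaks the ties of all voters at once. *)
Definition total (V : 'I_N -> bool -> act N -> R) u : R :=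
  \sum_i expect pi (V i) (fun w x => u (i, w, x)).

Lemma total_set_coord V u i b :
  total V u - total V (set_coord u i b) =
  expect pi (V i) (fun w x => u (i, w, x)) - expect pi (V i) b.
Proof.
rewrite /total (bigD1 i) //= [in X in _ - X](bigD1 i) //=.
rewrite [in X in _ - X](eq_bigr (fun j => expect pi (V j) (fun w x => u (j, w, x)))).
  rewrite opprD addrACA subrr addr0; congr (_ - expect _ _ _).
  by apply/funext => w; apply/funext => x; rewrite /set_coord /= eqxx.
move=> j /negbTE ji; congr (expect _ _ _).
by apply/funext => w; apply/funext => x; rewrite /set_coord /= ji.
Qed.

Lemma cvg_expect (V : bool -> act N -> R) (u_ : nat -> bool -> act N -> R) v :
  (forall w x, u_ n w x @[n --> \oo] --> v w x) ->
  expect pi V (u_ n) @[n --> \oo] --> expect pi V v.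
Proof.
move=> cu; apply: cvg_big => [|w _]; first exact: add_continuous.
apply: cvgMr; apply: cvg_big => [|x _]; first exact: add_continuous.
by apply: cvgMl.
Qed.

Section Continuity.
Import ArrowAsProduct.

Lemma continuous_vwelfare : continuous (fun u : index -> R => vwelfare pi u).
Proof.
apply: continuous_sum => w; apply: continuous_mull; apply: continuous_sum => a.
by apply: continuous_mulr; apply: continuous_prod => j; exact: continuous_coord.
Qed.

Lemma continuous_total V : continuous (fun u : index -> R => total V u).
Proof.
apply: continuous_sum => i; apply: continuous_sum => w; apply: continuous_mull.
by apply: continuous_sum => x; apply: continuous_mulr; exact: continuous_coord.
Qed.

Lemma attainable_lex_max V2 V3 : exists2 v, attainable v & forall u, attainable u ->
  vwelfare pi u <= vwelfare pi v /\
  (vwelfare pi v <= vwelfare pi u -> total V2 u <= total V2 v /\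
    (total V2 v <= total V2 u -> total V3 u <= total V3 v)).
Proof.
have [cK clK] := approx_set_compact (fun u au t => attainable_bound t au)
  attainable_approx.
apply: (@compact_lex_max (index -> R) _ attainable) => //.
(* Any sincere profile would show that the set is nonempty; this one replies to zero payoffs. *)
- pose b i := best_strategy pi (fun _ _ => 0) (fun _ _ => 0) i.
  exists (act_probs P Q b); apply: attainable_act_probs => i.
  exact: best_strategy_sincere.
- exact: continuous_vwelfare.
- exact: continuous_total.
- exact: continuous_total.
Qed.

End Continuity.

Lemma expect_sincere V i h : sincere i h ->
  expect pi V (act_prob P Q i h) =
  sint (Q i) (P i PI) (fun q s => payoff pi V q s (h PI q s)) +
  \sum_(p | p != PI) sint (Q i) (P i p) (fun q s => payoff pi V q s (pvote N p)).
Proof.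
move=> [vh ph]; rewrite expect_act_prob; last exact: valid_mstrategy vh.
rewrite (bigD1 PI) //=; congr (_ + _); apply: eq_bigr => p pI.
by rewrite ph.
Qed.

(** Moving [i] to the best reply stays attainable, so it cannot improve on [v]; conversely,
    strategies approximating [v] cannot beat a pointwise best reply. Each criterion thus ties in the
    limit, and [cvg_disagreement] applied three times forces the actions themselves to agree up to
    vanishing mass. *)
Lemma lex_max_attained Phi v i : attainable v ->
  (forall u, attainable u ->
    vwelfare pi u <= vwelfare pi v /\
    (vwelfare pi v <= vwelfare pi u -> total Phi u <= total Phi v /\
     (total Phi v <= total Phi u ->
      total (fun=> @act_rank R N) u <= total (fun=> @act_rank R N) v))) ->
  forall w x, v (i, w, x) =
    act_prob P Q i (best_strategy pi (pivot i v) (Phi i) i) w x.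
Proof.
move=> av vmax.
set V1 := pivot i v; set beta := best_strategy pi V1 (Phi i) i.
have gb : sincere i beta by exact: best_strategy_sincere.
set b := act_prob P Q i beta.
pose vi w x := v (i, w, x).
have [max1 max23] := vmax _ (attainable_set_coord av gb).
have W v' : pivot i v' = V1 -> vwelfare pi v' = expect pi V1 (fun w x => v' (i, w, x)).
  by move=> e; rewrite (vwelfare_pivot pi i) e.
rewrite !W ?pivot_set_coord // in max1 max23.
have setE : (fun w x => set_coord v i b (i, w, x)) = b.
  by apply/funext => w; apply/funext => x; rewrite /set_coord /= eqxx.
rewrite setE in max1 max23.
have Tset V : total V v =
    total V (set_coord v i b) + (expect pi (V i) vi - expect pi (V i) b).
  by rewrite -total_set_coord; ring.
have {}max23 : expect pi V1 vi <= expect pi V1 b ->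
    expect pi (Phi i) b <= expect pi (Phi i) vi /\
    (expect pi (Phi i) vi <= expect pi (Phi i) b ->
     expect pi (@act_rank R N) b <= expect pi (@act_rank R N) vi).
  move=> /max23; rewrite !Tset => -[m2 m3]; split; first by lra.
  by move=> l2; have := m3; rewrite (_ : _ <= _ = true); [move=> /(_ isT); lra|lra].
have /choice[sg sgP] (n : nat) : exists sigma, (forall i, sincere i (sigma i)) /\
    forall t, `|act_probs P Q sigma t - v t| < n.+1%:R^-1.
  have n0 : 0 < n.+1%:R^-1 :> R by rewrite invr_gt0.
  by have [sigma gs su] := av _ n0; exists sigma.
have gs n := (sgP n).1 i.
have cvg_v w x : act_prob P Q i (sg n i) w x @[n --> \oo] --> vi w x.
  apply/cvgrPdist_lt => e e0; near=> n.
  rewrite distrC; apply: lt_trans ((sgP n).2 (i, w, x)) _.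
  by near: n; exact: (near_infty_natSinv_lt (PosNum e0)).
(* The partisan contribution is common to all sincere strategies, so only the independents' part [I]
   is compared. *)
pose rest V := \sum_(p | p != PI) sint (Q i) (P i p)
  (fun q s => payoff pi V q s (pvote N p)).
pose I (V : bool -> act N -> R) h :=
  sint (Q i) (P i PI) (fun q s => payoff pi V q s (h q s)).
have cvgI V : I V (sg n i PI) @[n --> \oo] --> expect pi V vi - rest V.
  rewrite (_ : (fun n => _) = fun n => expect pi V (act_prob P Q i (sg n i)) - rest V).
    by apply: cvgB; [exact: cvg_expect | exact: cvg_cst].
  by apply/funext => n; rewrite (expect_sincere V (gs n)) addrK.
have Ib V : I V (beta PI) = expect pi V b - rest V.
  by rewrite (expect_sincere V gb) addrK.
have mb : mstrat (beta PI) := valid_mstrategy gb.1 PI.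
have mh n : mstrat (sg n i PI) := valid_mstrategy (gs n).1 PI.
have bpay (V : bool -> act N -> R) s x := bmeas_payoff pi V s x.
have meq V n s : measurable_fun prec_set (fun q =>
    payoff pi V q s (sg n i PI q s) == payoff pi V q s (beta PI q s)).
  by apply: measurable_fun_eqr;
    [case: (bmeas_strat (bpay V) (mh n) s) | case: (bmeas_strat (bpay V) mb s)].
have lexb n q s := (bestP pi V1 (Phi i) i q s).2 _ ((gs n).1.1 PI q s).
(* No criterion precedes the first, so the earlier agreement is constantly [true]. *)
have [e1 l1] : sint (Q i) (P i PI) (fun q s => (~~ (true &&
    (payoff pi V1 q s (sg n i PI q s) == payoff pi V1 q s (beta PI q s))))%:R)
    @[n --> \oo] --> (0 : R) /\ expect pi V1 vi - rest V1 <= I V1 (beta PI).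
  apply: (@cvg_disagreement _ _ _ _ (P0 i PI) (payoff pi V1) (beta PI)
    (fun n => sg n i PI) (fun _ _ _ => true) _ (bpay V1) mb mh) => //.
  - by move=> n q s _ _; case: (lexb n q s).
  - rewrite (_ : (fun n => _) = fun=> 0); first exact: cvg_cst.
    apply/funext => n; rewrite /sint big1 ?mulr0 // => s _.
    by rewrite Rintegral_cst ?mul0r //; exact: measurable_prec_set.
  - exact: cvgI.
  - by rewrite -/(I V1 (beta PI)) Ib lerD2r.
rewrite Ib lerD2r in l1; have [max2 max3] := max23 l1.
have [e2 l2] : sint (Q i) (P i PI) (fun q s => (~~ ((true &&
    (payoff pi V1 q s (sg n i PI q s) == payoff pi V1 q s (beta PI q s))) &&
    (payoff pi (Phi i) q s (sg n i PI q s) == payoff pi (Phi i) q s (beta PI q s))))%:R)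
    @[n --> \oo] --> (0 : R) /\
    expect pi (Phi i) vi - rest (Phi i) <= I (Phi i) (beta PI).
  apply: (@cvg_disagreement _ _ _ _ (P0 i PI) (payoff pi (Phi i)) (beta PI)
    (fun n => sg n i PI) _ _ (bpay (Phi i)) mb mh _ _ e1) => //.
  - by move=> n s; exact: meq.
  - move=> n q s _ /= /eqP a1; case: (lexb n q s) => _.
    by rewrite [in X in (X -> _) -> _]a1 lexx => /(_ isT) [].
  - exact: cvgI.
  - by rewrite -/(I (Phi i) (beta PI)) Ib lerD2r.
rewrite Ib lerD2r in l2; have {}max3 := max3 l2.
have [e3 _] : sint (Q i) (P i PI) (fun q s => (~~ (((true &&
    (payoff pi V1 q s (sg n i PI q s) == payoff pi V1 q s (beta PI q s))) &&
    (payoff pi (Phi i) q s (sg n i PI q s) == payoff pi (Phi i) q s (beta PI q s))) &&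
    (payoff pi (@act_rank R N) q s (sg n i PI q s) ==
     payoff pi (@act_rank R N) q s (beta PI q s))))%:R)
    @[n --> \oo] --> (0 : R) /\
    expect pi (@act_rank R N) vi - rest (@act_rank R N) <= I (@act_rank R N) (beta PI).
  apply: (@cvg_disagreement _ _ _ _ (P0 i PI) (payoff pi (@act_rank R N)) (beta PI)
    (fun n => sg n i PI) _ _ (bpay (@act_rank R N)) mb mh _ _ e2) => //.
  - by move=> n s; apply: measurable_and; exact: meq.
  - move=> n q s _ /= /andP[/eqP a1 /eqP a2]; case: (lexb n q s) => _.
    rewrite [in X in (X -> _) -> _]a1 lexx => /(_ isT) [_].
    by rewrite [in X in (X -> _) -> _]a2 lexx => /(_ isT).
  - exact: cvgI.
  - by rewrite -/(I _ (beta PI)) Ib lerD2r.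
move=> w x; apply/eqP; rewrite -subr_eq0 -normr_le0.
(* The distance to [b] is bounded by the mass of disagreement, which tends to 0, while its limit is
   the distance from [v] to [b]. *)
have cvgd : `|act_prob P Q i (sg n i) w x - b w x| @[n --> \oo] -->
    `|v (i, w, x) - b w x|.
  by apply: cvg_norm; apply: cvgB; [exact: cvg_v | exact: cvg_cst].
apply: (ler_cvg_to cvgd e3); apply: nearW => n; apply: act_prob_diff => //.
- exact: valid_mstrategy (gs n).1.
- exact: valid_mstrategy gb.1.
- by move=> p pI; rewrite (gs n).2 // gb.2.
- by move=> s; apply: measurable_and; [apply: measurable_and|]; exact: meq.
- by move=> q s Dq /andP[_ /eqP]; exact: payoff_act_rank_inj.
Unshelve. all: by end_near. Qed.

(** Welfare, the first criterion, makes the replies to the maximizer optimal; the second makes them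
    undominated. *)
Lemma liquid_equilibrium sigma : (forall i, sincere i (sigma i)) ->
  exists2 tau, equilibrium pi P Q LD tau &
    vwelfare pi (act_probs P Q sigma) <= welfare pi P Q LD tau.
Proof.
move=> gs.
have /choice[Phi PhiP] (i : 'I_N) := dominance_functional pi P Q i.
have [v av vmax] := attainable_lex_max Phi (fun=> @act_rank R N).
pose tau i := best_strategy pi (pivot i v) (Phi i) i.
(* The profile of best replies to [v] reproduces [v], so it is a best reply to itself. *)
have tauE : act_probs P Q tau = v.
  by apply/funext => -[[i w] x]; rewrite (lex_max_attained i av vmax).
have st i : sincere i (tau i) by exact: best_strategy_sincere.
have vt : valid_profile LD tau by move=> i; case: (st i).
exists tau; last first.
  rewrite vwelfare_act_probs tauE.
  by have [] := vmax _ (attainable_act_probs gs).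
split=> //; split; first by move=> i; exact: best_strategy_threshold.
have bP i q s := bestP pi (pivot i v) (Phi i) i q s.
split=> [i p q s Dq|i p q s x Dq ax]; last first.
  have [->|pI] := eqVneq p PI; last by rewrite (st i).2 //; exact: interim_EU_partisan.
  rewrite !interim_EU_PI tauE ler_pM2r ?invr_gt0 ?likelihood_gt0 //.
  by have [] := (bP i q s).2 _ ax.
case=> y ay [le_all [rho vrho lt_rho]].
have [pI|pI] := eqVneq p PI; last first.
  move: lt_rho; rewrite (st i).2 // ltNge => /negP; apply.
  exact: interim_EU_partisan.
rewrite pI in le_all lt_rho.
have dom : vdominates pi P Q i q s (best pi (pivot i v) (Phi i) i q s) y.
  split=> [rho' vrho'|].
    have := le_all _ vrho'.
    by rewrite !interim_EU_PI ler_pM2r ?invr_gt0 ?likelihood_gt0.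
  exists rho => //; move: lt_rho.
  by rewrite !interim_EU_PI ltr_pM2r ?invr_gt0 ?likelihood_gt0.
(* A dominating [y] would do at least as well against [tau] and strictly better for [Phi],
   contradicting the lexicographic choice. *)
have [_ /(_ _)] := (bP i q s).2 _ ay.
have := dom.1 _ vt; rewrite tauE => -> /(_ isT) [+ _].
by rewrite leNgt (PhiP _ _ _ _ _ dom).
Qed.

End Existence.

Theorem theorem2 (R : realType) (N : nat) (pi : R)
  (P : 'I_N -> party -> R) (Q : 'I_N -> probability R R)
  (J : {set 'I_N}) :
  0 < pi < 1 ->
  (forall i p, 0 <= P i p) ->
  (forall i, \sum_(p : party) P i p = 1) ->
  (forall i, Q i prec_set = 1%E) ->
  (forall sigma, equilibrium pi P Q DD sigma ->
     exists2 tau, equilibrium pi P Q LD tau &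
       welfare pi P Q DD sigma <= welfare pi P Q LD tau) /\
  (forall sigma, equilibrium pi P Q (RD J) sigma ->
     exists2 tau, equilibrium pi P Q LD tau &
       welfare pi P Q (RD J) sigma <= welfare pi P Q LD tau).
Proof.
move=> pi01 P0 P1 _.
have main M sigma : equilibrium pi P Q M sigma ->
    exists2 tau, equilibrium pi P Q LD tau &
      welfare pi P Q M sigma <= welfare pi P Q LD tau.
  move=> [vs [ts _]]; rewrite (welfare_reduced pi P Q vs).
  by apply: liquid_equilibrium => // i; exact: (reduced_sincere i vs ts).
by split; exact: main.
Qed.
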